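(* Let $\mathfrak g$ be one of the real Lie algebras $\mathfrak g_{4,7}$; $\mathfrak g^{\alpha}_{4,9}$, $\alpha\ge0$; $\mathfrak g^{\alpha}_{4,8}$, $-1\le\alpha\le1$, and let $\mathfrak I=\mathrm{span}(E_1,E_2,E_3)$ be its three-dimensional ideal. All these Lie algebras, except $\mathfrak g^1_{4,8}$, have two-dimensional generating subspaces. A two-dimensional subspace $\mathfrak p\subset\mathfrak g$ generates $\mathfrak g$ if and only if it is not contained in $\mathfrak I$ and intersects by zero every ideal $\mathfrak J$ of $\mathfrak g$ with $\mathfrak J\subset\mathfrak I$, $\mathfrak J\neq\mathfrak I$. Any two generating two-dimensional subspaces of $\mathfrak g$ are translated to each other by an automorphism of $\mathfrak g$. In addition, every generating two-dimensional subspace $\mathfrak p$ has a basis $(e_1,e_2)$ with $e_1\in\mathfrak p\cap\mathfrak I$ such that, with $e_3:=[e_1,e_2]$, $e_4:=[e_1,e_3]$, the vectors $(e_1,e_2,e_3,e_4)$ form a basis of $\mathfrak g$ with $C_{23}^4=0$; for such a basis $C^1_{23}\neq0$, $C^2_{23}=0$ if $\mathfrak g$ is $\mathfrak g_{4,7}$, $\mathfrak g^\alpha_{4,9}$, or $\mathfrak g^{\alpha}_{4,8}$ with $\alpha\ne0$, and $C^1_{23}=C^2_{23}=0$ if $\mathfrak g=\mathfrak g^0_{4,8}$.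
   Context: A subspace is generating if the smallest Lie subalgebra containing it is $\mathfrak g$. $C_{ij}^k$ are the structure constants: $[e_i,e_j]=\sum_kC_{ij}^ke_k$. The Lie algebras are given in a basis $E_1,\dots,E_4$ by their nonzero brackets: $\mathfrak g_{4,7}$: $[E_1,E_4]=2E_1$, $[E_2,E_4]=E_2$, $[E_3,E_4]=E_2+E_3$, $[E_2,E_3]=E_1$; $\mathfrak g^{\alpha}_{4,8}$ ($-1\le\alpha\le1$): $[E_1,E_4]=(1+\alpha)E_1$, $[E_2,E_4]=E_2$, $[E_3,E_4]=\alpha E_3$, $[E_2,E_3]=E_1$; $\mathfrak g^{\alpha}_{4,9}$ ($\alpha\ge0$): $[E_1,E_4]=2\alpha E_1$, $[E_2,E_4]=\alpha E_2-E_3$, $[E_3,E_4]=E_2+\alpha E_3$, $[E_2,E_3]=E_1$. *)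

(* Defs.v *)
From HB Require Import structures.
From mathcomp Require Import all_boot all_order all_algebra.
From mathcomp Require Import reals ring.

Set Implicit Arguments.
Unset Strict Implicit.
Unset Printing Implicit Defensive.

Import Order.TTheory GRing.Theory Num.Theory.
Local Open Scope ring_scope.

Record lieAlgebra (K : fieldType) := LieAlgebra {
  lie_space :> vectType K;
  lie : lie_space -> lie_space -> lie_space;
  lie_linearl : forall v, linear (lie^~ v);
  liexx : forall v, lie v v = 0;
  lie_jacobi : forall u v w,
    lie u (lie v w) + lie v (lie w u) + lie w (lie u v) = 0 }.

Arguments lie {K l}.

Definition subalgebra (K : fieldType) (L : lieAlgebra K) (U : {vspace L}) :=
  forall u v : L, u \in U -> v \in U -> lie u v \in U.

Definition ideal (K : fieldType) (L : lieAlgebra K) (J : {vspace L}) :=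
  forall u v : L, u \in J -> lie u v \in J.

(* The smallest subalgebra containing U is the whole of L. *)
Definition generating (K : fieldType) (L : lieAlgebra K) (U : {vspace L}) :=
  forall H : {vspace L}, subalgebra H -> (U <= H)%VS -> H = fullv.

Definition automorphism (K : fieldType) (L : lieAlgebra K) (f : 'End(L)) :=
  bijective f /\ forall u v : L, f (lie u v) = lie (f u) (f v).

(* C_{ij}^k relative to the basis e, with i, j, k counted from 1. *)
Definition struct_const (K : fieldType) (L : lieAlgebra K)
    (e : 4.-tuple L) (i j k : nat) : K :=
  coord e (inord k.-1) (lie e`_i.-1 e`_j.-1).

Definition frame (K : fieldType) (L : lieAlgebra K) (e1 e2 : L) : 4.-tuple L :=
  [tuple e1; e2; lie e1 e2; lie e1 (lie e1 e2)].

Definition adapted (K : fieldType) (L : lieAlgebra K) (I p : {vspace L})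
    (e1 e2 : L) : Prop :=
  [/\ basis_of p [:: e1; e2],
      e1 \in (p :&: I)%VS,
      basis_of fullv (frame e1 e2) &
      struct_const (frame e1 e2) 2 3 4 = 0].

Variant g4 (R : realType) := g47 | g48 of R | g49 of R.

Arguments g47 {R}.

Definition admissible (R : realType) (g : g4 R) : Prop :=
  match g with
  | g47 => True
  | g48 a => -1 <= a <= 1
  | g49 a => 0 <= a
  end.

(* E 1, ..., E 4 is the standard basis of R^4. *)
Definition E (R : realType) (k : nat) : 'rV[R]_4 := \row_(j < 4) (j.+1 == k)%:R.

Arguments E {R} k.

(* table g i j = [E_i, E_j] for i < j *)
Definition table (R : realType) (g : g4 R) (i j : nat) : 'rV[R]_4 :=
  match g, i, j with
  | g47, 1%N, 4%N => 2 *: E 1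
  | g47, 2%N, 4%N => E 2
  | g47, 3%N, 4%N => E 2 + E 3
  | g47, 2%N, 3%N => E 1
  | g48 a, 1%N, 4%N => (1 + a) *: E 1
  | g48 a, 2%N, 4%N => E 2
  | g48 a, 3%N, 4%N => a *: E 3
  | g48 a, 2%N, 3%N => E 1
  | g49 a, 1%N, 4%N => (2 * a) *: E 1
  | g49 a, 2%N, 4%N => a *: E 2 - E 3
  | g49 a, 3%N, 4%N => E 2 + a *: E 3
  | g49 a, 2%N, 3%N => E 1
  | _, _, _ => 0
  end.

Definition g4_lie (R : realType) (g : g4 R) (u v : 'rV[R]_4) : 'rV[R]_4 :=
  \sum_(i < 4) \sum_(j < 4 | (i < j)%N)
    (u 0 i * v 0 j - u 0 j * v 0 i) *: table g i.+1 j.+1.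

Lemma g4_lie_linearl (R : realType) (g : g4 R) v : linear ((g4_lie g)^~ v).
Proof.
move=> a x y; rewrite /g4_lie scaler_sumr -big_split; apply: eq_bigr => i _ /=.
rewrite scaler_sumr -big_split; apply: eq_bigr => j _ /=.
by rewrite scalerA -scalerDl !mxE; congr (_ *: _); ring.
Qed.

Lemma g4_liexx (R : realType) (g : g4 R) v : g4_lie g v v = 0.
Proof.
rewrite /g4_lie; apply: big1 => i _; apply: big1 => j _.
by rewrite mulrC subrr scale0r.
Qed.

Lemma sum_lt4 (V : nmodType) (F : 'I_4 -> 'I_4 -> V) :
  \sum_(i < 4) \sum_(j < 4 | (i < j)%N) F i j =
  F 0 1 + F 0 2 + F 0 3 + F 1 2 + F 1 3 + F 2 3.
Proof.
under eq_bigr do rewrite big_mkcond /=.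
rewrite !big_ord_recl !big_ord0 /=.
have -> : lift ord0 ord0 = 1 :> 'I_4 by apply: val_inj.
have -> : lift ord0 (lift ord0 ord0) = 2 :> 'I_4 by apply: val_inj.
have -> : lift ord0 (lift ord0 (lift ord0 ord0)) = 3 :> 'I_4
  by apply: val_inj.
by rewrite !(add0r, addr0) !addrA.
Qed.

Lemma g4_lie_coord (R : realType) (g : g4 R) :
  exists p q r s : R, forall u v : 'rV[R]_4,
    let d i j := u 0 i * v 0 j - u 0 j * v 0 i in
    [/\ g4_lie g u v 0 0 = (p + s) * d 0 3 + d 1 2,
        g4_lie g u v 0 1 = p * d 1 3 + r * d 2 3,
        g4_lie g u v 0 2 = q * d 1 3 + s * d 2 3 &
        g4_lie g u v 0 3 = 0].
Proof.
case: g => [|a|a]; [exists 1, 0, 1, 1 | exists 1, 0, 0, a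
  | exists a, (-1), 1, a]; move=> u v d; rewrite /g4_lie sum_lt4 -!/(d _ _);
  move: (d 0 1) (d 0 2) (d 0 3) (d 1 2) (d 1 3) (d 2 3)
    => d01 d02 d03 d12 d13 d23; split; rewrite !mxE /=; ring.
Qed.

Lemma g4_lie_jacobi (R : realType) (g : g4 R) u v w :
  g4_lie g u (g4_lie g v w) + g4_lie g v (g4_lie g w u)
  + g4_lie g w (g4_lie g u v) = 0.
Proof.
have [p [q [r [s c]]]] := g4_lie_coord g.
apply/rowP => k; rewrite [LHS]mxE [X in X + _]mxE [RHS]mxE.
have [c1 c2 c3 c4] := c v w.
have [c5 c6 c7 c8] := c w u.
have [c9 c10 c11 c12] := c u v.
have ord4 : [\/ k = 0, k = 1, k = 2 | k = 3].
  by case: k => [[|[|[|[|//]]]] ltk];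
    [constructor 1 | constructor 2 | constructor 3 | constructor 4];
    apply: val_inj.
have [e1 e2 e3 e4] := c u (g4_lie g v w).
have [e5 e6 e7 e8] := c v (g4_lie g w u).
have [e9 e10 e11 e12] := c w (g4_lie g u v).
case: ord4 => ->; rewrite ?(e1, e2, e3, e4, e5, e6, e7, e8, e9, e10, e11, e12)
  ?(c1, c2, c3, c4, c5, c6, c7, c8, c9, c10, c11, c12); ring.
Qed.

Definition g4_algebra (R : realType) (g : g4 R) : lieAlgebra R :=
  @LieAlgebra R 'rV[R]_4 (g4_lie g) (g4_lie_linearl g) (@g4_liexx R g)
    (@g4_lie_jacobi R g).

Definition I3 (R : realType) (g : g4 R) : {vspace g4_algebra g} :=
  <<[:: E 1; E 2; E 3] : seq 'rV[R]_4>>%VS.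

Lemma g4_lieE (R : realType) (g : g4 R) (i j : nat) :
  (0 < i)%N -> (i < j)%N -> (j <= 4)%N -> g4_lie g (E i) (E j) = table g i j.
Proof.
rewrite /g4_lie sum_lt4 !mxE.
case: i => [//|[|[|[|i]]]]; case: j => [//|[|[|[|[|j]]]]] //= _ _ _;
  by rewrite ?(mulr0, mul0r, mulr1, subr0) ?scale0r ?scale1r ?(add0r, addr0).
Qed.

Lemma I3_ideal (R : realType) (g : g4 R) : ideal (I3 g).
Proof.
have [p [q [r [s c]]]] := g4_lie_coord g.
move=> u v _; have [_ _ _] := c u v.
change (lie u v) with (g4_lie g u v); move: (g4_lie g u v) => w w3.
have -> : w = w 0 0 *: E 1 + w 0 1 *: E 2 + w 0 2 *: E 3.
  apply/rowP => -[[|[|[|[|//]]]] ltk]; rewrite !mxE /=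
    ?(mulr0, mulr1, addr0, add0r).
  - by congr (w 0 _); apply: val_inj.
  - by congr (w 0 _); apply: val_inj.
  - by congr (w 0 _); apply: val_inj.
  - by rewrite -w3; congr (w 0 _); apply: val_inj.
have memE k : (0 < k < 4)%N -> (E k : g4_algebra g) \in I3 g.
  move=> k4; apply: memv_span.
  by case: k k4 => [|[|[|[|k]]]] // _; rewrite !inE eqxx ?orbT.
by apply: (@rpredD (g4_algebra g)); [apply: (@rpredD (g4_algebra g))|];
  apply: (@rpredZ R (g4_algebra g)); apply: memE.
Qed.

Lemma I3_dim (R : realType) (g : g4 R) : \dim (I3 g) = 3%N.
Proof.
apply/eqP; rewrite -[3%N]/(size [:: E 1; E 2; E 3 : 'rV[R]_4]) -/(free _).
apply/(@freeP R 'rV[R]_4 3 [tuple E 1; E 2; E 3]) => k.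
rewrite !big_ord_recl big_ord0 /= addr0 => /rowP k0 i.
have := k0 (widen_ord (leqnSn 3) i); rewrite !mxE.
by case: i => [[|[|[|//]]] lti] /=; rewrite ?(mulr0, mulr1, addr0, add0r) => <-;
  congr (k _); apply: val_inj.
Qed.

(* Main.v *)
(** Write M for the action of [., E_4] on I / <E_1>. A plane p not contained in
I has a basis (e1, e2) with e1 in I and E_4-coordinate of e2 equal to 1. Put
e3 = [e1, e2] and e4 = [e1, e3]; then e4 is E_1 times the determinant of
(e1, M e1) modulo E_1. If this determinant is nonzero, e1, e2, e3, e4 is a basis
of g and p is generating. Otherwise M e1 is a multiple of e1 modulo E_1, so
<e1, E_1> is an ideal smaller than I that meets p, and p + <E_1> is a proper
subalgebra. For g^1_{4,8}, and only for it, M is scalar, so the determinant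
always vanishes. By Cayley-Hamilton, [e2, e3] = det M e1 - tr M e3 modulo E_1;
subtracting a multiple of e1 from e2 removes the E_1-component, after which the
brackets of the basis depend on det M and tr M only, whence the transitivity of
the automorphism group. Finally det M = 0 exactly for g^0_{4,8}. *)

Require Import Defs.
From HB Require Import structures.
From mathcomp Require Import all_boot all_order all_algebra.
From mathcomp Require Import reals ring.

Set Implicit Arguments.
Unset Strict Implicit.
Unset Printing Implicit Defensive.

Import Order.TTheory GRing.Theory Num.Theory.
Local Open Scope ring_scope.

Arguments lie {K l} u v : simpl never.

(** * Skew-symmetric brackets: bilinearity, automorphisms from bases, subalgebras *)

Section SkewBracket.
Variables (K : fieldType) (L : lieAlgebra K).
(* Not automatic: lieAlgebra only asks for linearity on the left. *)
Hypothesis lieC : forall u v : L, lie u v = - lie v u.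
Implicit Types (u v w x : L) (J : {vspace L}).

Lemma lieDl u v w : lie (u + v) w = lie u w + lie v w.
Proof. by have := lie_linearl w 1 u v; rewrite /= !scale1r. Qed.

Lemma lie0l v : lie 0 v = 0.
Proof.
by have := lie_linearl v (-1) 0 0; rewrite scaler0 addr0 scaleN1r addNr.
Qed.

Lemma lieZl a u v : lie (a *: u) v = a *: lie u v.
Proof. by have := lie_linearl v a u 0; rewrite /= lie0l !addr0. Qed.

Lemma lieDr u v w : lie u (v + w) = lie u v + lie u w.
Proof. by rewrite lieC lieDl opprD -!lieC. Qed.

Lemma lieZr a u v : lie u (a *: v) = a *: lie u v.
Proof. by rewrite lieC lieZl -scalerN -lieC. Qed.

Lemma lie_sumlr n (X Y : 'I_n -> L) :
  lie (\sum_i X i) (\sum_j Y j) = \sum_i \sum_j lie (X i) (Y j).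
Proof.
rewrite (big_morph _ (fun u v => lieDl u v _) (lie0l _)).
apply: eq_bigr => i _; apply: (big_morph _ (lieDr _)).
by rewrite lieC lie0l oppr0.
Qed.

(** Bijectivity is rank-nullity, since the image contains the basis [e']. Skew-symmetry and
    bilinearity reduce compatibility with the bracket to pairs [i < j]. *)
Lemma automorphism_of_bases (e e' : 4.-tuple (L)) :
    basis_of fullv e -> basis_of fullv e' ->
  exists2 f : 'End(L), map f e = e' &
    (forall i j : 'I_4, (i < j)%N -> f (lie e`_i e`_j) = lie e'`_i e'`_j) ->
    automorphism f.
Proof.
move=> be be'; have [f0] := linear_of_free e e'.
move=> /(_ (basis_free be)); rewrite !size_tuple => /(_ erefl) f0e.
pose f := linfun f0.
have fe : map f e = e' by rewrite -f0e; apply: eq_map => u; rewrite lfunE.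
have fi (i : 'I_4) : f e`_i = e'`_i by rewrite -fe (nth_map 0) ?size_tuple.
exists f => // hf; split.
  have kf : lker f == 0%VS.
    rewrite -dimv_eq0 -(eqn_add2r (\dim (f @: fullv))%VS) -{1}(capfv (lker f)).
    rewrite limg_ker_dim -(span_basis be) limg_span fe.
    by rewrite (span_basis be) (span_basis be').
  by exists f^-1%VF; [exact: lker0_lfunK|exact: lker0_lfunVK].
have fij (i j : 'I_4) : f (lie e`_i e`_j) = lie (f e`_i) (f e`_j).
  rewrite !fi; have [|ltji|/val_inj <-] := ltngtP i j; first exact: hf.
    by rewrite lieC linearN /= hf // -lieC.
  by rewrite !liexx linear0.
move=> u v.
rewrite (coord_basis be (memvf u)) (coord_basis be (memvf v)) lie_sumlr.
rewrite !linear_sum lie_sumlr; apply: eq_bigr => i _.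
rewrite linear_sum; apply: eq_bigr => j _.
by rewrite !(lieZl, lieZr, linearZ) /= fij scalerA mulrC -scalerA.
Qed.

(** Expanding a bracket of two elements, the only term without a factor in [J] is a multiple of
    [x, x] = 0; the result even lies in [J]. *)
Lemma subalgebra_ideal_line J x : ideal J -> subalgebra (J + <[x]>)%VS.
Proof.
move=> idJ y z /memv_addP[u Ju [_ /vlineP[a ->] ->]].
move=> /memv_addP[v Jv [_ /vlineP[b ->] ->]].
apply: (subvP (addvSl J <[x]>)).
rewrite lieDl !lieDr !lieZl !lieZr liexx !scaler0.
by rewrite addr0 (lieC x v) !rpredD // ?rpredZ ?rpredN //; apply: idJ.
Qed.

End SkewBracket.

(** * Brackets in coordinates: the action M of [., E_4] on I / <E_1> *)

Section G4.
Variables (R : realType) (g : g4 R).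
Implicit Types (u v w x : g4_algebra g) (U J p : {vspace g4_algebra g}).

Lemma g4_lieC u v : lie u v = - lie v u.
Proof.
rewrite /lie /= /g4_lie -sumrN; apply: eq_bigr => i _.
rewrite -sumrN; apply: eq_bigr => j _.
by rewrite -scaleNr opprB mulrC (mulrC (u 0 j)).
Qed.

Lemma row4P u v :
  [/\ u 0 0 = v 0 0, u 0 1 = v 0 1, u 0 2 = v 0 2 & u 0 3 = v 0 3] -> u = v.
Proof.
case=> h0 h1 h2 h3; apply/rowP => -[[|[|[|[|//]]]] lti].
- by rewrite [Ordinal _](_ : _ = 0) //; apply: val_inj.
- by rewrite [Ordinal _](_ : _ = 1) //; apply: val_inj.
- by rewrite [Ordinal _](_ : _ = 2) //; apply: val_inj.
- by rewrite [Ordinal _](_ : _ = 3) //; apply: val_inj.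
Qed.

(* The matrix of [., E_4] on I / <E_1>: [E_(i+1), E_4] is
   ad4 i 1 *: E_2 + ad4 i 2 *: E_3 modulo E_1. *)
Definition ad4 (i j : 'I_4) : R := table g i.+1 4 0 j.

Definition ad4_tr : R := ad4 1 1 + ad4 2 2.

Definition ad4_det : R := ad4 1 1 * ad4 2 2 - ad4 1 2 * ad4 2 1.

(* The determinant of the classes of u and [u, E_4] in I / <E_1>. *)
Definition wedge u : R :=
  u 0 1 * (u 0 1 * ad4 1 2 + u 0 2 * ad4 2 2)
  - u 0 2 * (u 0 1 * ad4 1 1 + u 0 2 * ad4 2 1).

Lemma lie_coord u v : let d i j := u 0 i * v 0 j - u 0 j * v 0 i in
  [/\ lie u v 0 0 = ad4_tr * d 0 3 + d 1 2,
      lie u v 0 1 = ad4 1 1 * d 1 3 + ad4 2 1 * d 2 3,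
      lie u v 0 2 = ad4 1 2 * d 1 3 + ad4 2 2 * d 2 3 &
      lie u v 0 3 = 0].
Proof.
move=> d; rewrite /ad4_tr /ad4 /lie /= /g4_lie sum_lt4 -!/(d _ _).
move: (d 0 1) (d 0 2) (d 0 3) (d 1 2) (d 1 3) (d 2 3)
  => d01 d02 d03 d12 d13 d23.
by case: g => [|a|a]; split; rewrite !mxE /=; ring.
Qed.

(** The determinant is 1 for g_{4,7}, a for g_{4,8}^a and a^2 + 1 for g_{4,9}^a. *)
Lemma ad4_det_eq0 : ad4_det = 0 <-> g = g48 0.
Proof.
rewrite /ad4_det /ad4; case: g => [|a|a] /=; rewrite !mxE /=.
- split=> // /eqP.
  by rewrite !(mulr0, mulr1, addr0, add0r, subr0, mul0r) oner_eq0.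
- rewrite !(mulr0, mulr1, addr0, add0r, subr0, mul0r, mul1r).
  by split=> [->|[]].
- split=> // /eqP.
  rewrite !(mulr0, mulr1, addr0, add0r, subr0, mul0r, mul1r) opprK.
  by rewrite paddr_eq0 ?ler01 // ?sqr_ge0 // oner_eq0 andbF.
Qed.

Lemma wedge_g48_1 u : g = g48 1 -> wedge u = 0.
Proof. by move=> g1; rewrite /wedge /ad4 g1 /= !mxE /=; ring. Qed.

(** The witness is a vector whose class is not an eigenvector of M. For g_{4,8}^a both E_2 and E_3
    are eigenvectors, but [wedge] takes the value a - 1 at their sum. *)
Lemma wedge_neq0 :
  g <> g48 1 -> exists2 u : g4_algebra g, u 0 3 = 0 & wedge u != 0.
Proof.
rewrite /wedge /ad4; case: g => [|a|a] /= g1.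
- exists (E 3); first by rewrite mxE.
  rewrite !mxE /= !(mulr0, mulr1, addr0, add0r, mul0r, mul1r).
  by rewrite oppr_eq0 oner_eq0.
- exists (E 2 + E 3); first by rewrite !mxE addr0.
  rewrite !mxE /= !(mulr0, mulr1, addr0, add0r, mul0r, mul1r) subr_eq0.
  by apply/eqP => a1; case: g1; rewrite a1.
- exists (E 2); first by rewrite mxE.
  rewrite !mxE /= !(mulr0, mulr1, addr0, add0r, mul0r, mul1r).
  by rewrite subr0 oppr_eq0 oner_eq0.
Qed.

Lemma mem_I3 u : (u \in I3 g) = (u 0 3 == 0).
Proof.
apply/idP/eqP => [|u3].
  rewrite /I3 !span_cons span_nil addv0.
  move=> /memv_addP[_ /vlineP[a ->] [v /memv_addP[_ /vlineP[b ->]]]].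
  move=> [_ /vlineP[c ->] ->] ->.
  by rewrite !mxE /= !mulr0 !addr0.
have -> : u = u 0 0 *: (E 1 : g4_algebra g) + u 0 1 *: (E 2 : g4_algebra g)
    + u 0 2 *: (E 3 : g4_algebra g).
  by apply: row4P; split; rewrite !mxE /= ?u3; ring.
by rewrite !rpredD ?rpredZ //; apply: memv_span; rewrite !inE eqxx ?orbT.
Qed.

(** E_1 = [E_2, E_3] and [., E_4] is a derivation, so its eigenvalue at E_1 is the trace of M. *)
Lemma lie_E1 u :
  lie u (E 1 : g4_algebra g) = - (u 0 3 * ad4_tr) *: (E 1 : g4_algebra g).
Proof.
have [w0 w1 w2 w3] := lie_coord u (E 1).
by apply: row4P; rewrite w0 w1 w2 w3 !mxE /=; split; ring.
Qed.

(** Modulo E_1, [u, v] is [v 0 3] times M u. Inside I only [E_2, E_3] = E_1 survives, which makes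
    the outer bracket the determinant of the two classes. *)
Lemma lie_e1e3 u v : u 0 3 = 0 ->
  lie u (lie u v) = (v 0 3 * wedge u) *: (E 1 : g4_algebra g).
Proof.
move=> u3; have [_ w1 w2 w3] := lie_coord u v.
have [z0 z1 z2 z3] := lie_coord u (lie u v).
apply: row4P; rewrite z0 z1 z2 z3 w1 w2 w3 u3 /wedge.
by split; rewrite !mxE /=; ring.
Qed.

(* Cayley-Hamilton for the action of v on I / <E_1>. *)
Lemma lie_e2e3 u v : u 0 3 = 0 -> exists c,
  lie v (lie u v) = (v 0 3 ^+ 2 * ad4_det) *: u - (v 0 3 * ad4_tr) *: lie u v
    + c *: (E 1 : g4_algebra g).
Proof.
move=> u3; have [_ w1 w2 w3] := lie_coord u v.
have [z0 z1 z2 z3] := lie_coord v (lie u v).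
exists (lie v (lie u v) 0 0
  - ((v 0 3 ^+ 2 * ad4_det) *: u - (v 0 3 * ad4_tr) *: lie u v) 0 0).
have mE (a b c : g4_algebra g) k :
  (a - b + c) 0 k = a 0 k - b 0 k + c 0 k by rewrite !mxE.
have nE (a b : g4_algebra g) k : (a - b) 0 k = a 0 k - b 0 k by rewrite !mxE.
have sE a (b : g4_algebra g) k : (a *: b) 0 k = a * b 0 k by rewrite !mxE.
apply: row4P; rewrite !(mE, nE, sE) z1 z2 z3 w1 w2 w3 u3 /ad4_det /ad4_tr.
by split; rewrite !mxE /=; ring.
Qed.

(** Only [e2] lies outside I; [wedge e1] is the determinant of e1 and e3 modulo E_1, and e4 is a
    nonzero multiple of E_1. *)
Lemma basis_frame (e1 e2 : g4_algebra g) :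
  e1 0 3 = 0 -> e2 0 3 = 1 -> wedge e1 != 0 -> basis_of fullv (frame e1 e2).
Proof.
move=> e13 e23 W.
rewrite basisEfree subvf dimvf size_tuple; apply/and3P; split=> //.
apply/freeP => k; rewrite !big_ord_recl big_ord0 addr0 /= lie_e1e3 // e23 mul1r.
have [_ w1 w2 w3] := lie_coord e1 e2.
set k0 := k _; set k1 := k _; set k2 := k _; set k3 := k _ => H.
have H0 (j : 'I_4) : k0 * e1 0 j + (k1 * e2 0 j
    + (k2 * lie e1 e2 0 j + k3 * (wedge e1 * E 1 0 j))) = 0.
  by have := congr1 (fun u : 'rV[R]_4 => u 0 j) H; rewrite !mxE.
have k10 : k1 = 0.
  by have := H0 3; rewrite w3 e13 e23 mxE /= !(mulr0, add0r, addr0, mulr1).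
have := H0 1; have := H0 2; have := H0 0; rewrite w1 w2 k10 e13 e23 !mxE /=.
rewrite !(mulr0, add0r, addr0, mulr1, mul0r, sub0r, subr0).
move=> h0 h2 h1.
(* Cramer's rule: the relation k0 e1 + k2 M e1 = 0 modulo E_1, paired with M e1 and then with e1,
   leaves one coefficient times [wedge e1]. *)
have k00 : k0 = 0.
  apply: (mulIf W); rewrite mul0r /wedge.
  transitivity ((k0 * e1 0 1 + k2 * (ad4 1 1 * e1 0 1 + ad4 2 1 * e1 0 2))
      * (ad4 1 2 * e1 0 1 + ad4 2 2 * e1 0 2)
    - (k0 * e1 0 2 + k2 * (ad4 1 2 * e1 0 1 + ad4 2 2 * e1 0 2))
      * (ad4 1 1 * e1 0 1 + ad4 2 1 * e1 0 2)); first by ring.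
  by rewrite h1 h2 !mul0r subrr.
have k20 : k2 = 0.
  apply: (mulIf W); rewrite mul0r /wedge.
  transitivity
    ((k0 * e1 0 2 + k2 * (ad4 1 2 * e1 0 1 + ad4 2 2 * e1 0 2)) * e1 0 1
    - (k0 * e1 0 1 + k2 * (ad4 1 1 * e1 0 1 + ad4 2 1 * e1 0 2)) * e1 0 2);
    first by ring.
  by rewrite h1 h2 !mul0r subrr.
have k30 : k3 = 0 by apply: (mulIf W); move: h0; rewrite k00 k20 !mul0r !add0r.
move=> i; case: (unliftP 0 i) => [j|] -> //.
case: (unliftP 0 j) => [{}i|] -> //.
by case: (unliftP 0 i) => [{}j|] -> //; rewrite (ord1 j).
Qed.

(** * Generating planes and ideals inside I *)

Lemma plane_basis p : \dim p = 2%N -> ~ (p <= I3 g)%VS ->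
  exists e1 e2 : g4_algebra g,
    [/\ basis_of p [:: e1; e2], e1 0 3 = 0 & e2 0 3 = 1].
Proof.
move=> dp /negP/subvPn[x px]; rewrite mem_I3 => x3.
(* With zero intersection, the sum of p and I would have dimension 5. *)
have dpI : (p :&: I3 g)%VS != 0%VS.
  rewrite -dimv_eq0; apply/eqP => dpI.
  have := dimv_sum_cap p (I3 g); rewrite dpI dp I3_dim addn0 => d5.
  by have := dimvS (subvf (p + I3 g)%VS); rewrite d5 dimvf.
have := memv_pick (p :&: I3 g)%VS; have := vpick0 (p :&: I3 g)%VS.
rewrite (negPf dpI); set e1 := vpick _; rewrite memv_cap mem_I3 => e10.
case/andP=> pe1 /eqP e13.
pose e2 : g4_algebra g := (x 0 3)^-1 *: x.
have e23 : e2 0 3 = 1 by rewrite mxE mulVf.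
exists e1, e2; split=> //; rewrite basisEfree dp leqnn andbT; apply/andP; split.
  rewrite free_cons seq1_free span_seq1; apply/andP; split.
    apply/negP => /vlineP[a e1E]; have := e13; rewrite e1E mxE e23 mulr1 => a0.
    by move: e10; rewrite e1E a0 scale0r eqxx.
  by apply/eqP => e20; move/eqP: e23; rewrite e20 mxE eq_sym oner_eq0.
by rewrite span_cons span_seq1 subv_add -!memvE pe1 rpredZ.
Qed.

Lemma wedge0_ideal (e1 : g4_algebra g) : e1 0 3 = 0 -> wedge e1 = 0 ->
  ideal (<[e1]> + <[E 1]>)%VS.
Proof.
move=> e13 W.
(* [mu] is the eigenvalue of M at the class of [e1], read off as a ratio in a nonzero coordinate. If
   the class is zero, any value works and 0 is taken. *)
have [mu [mu1 mu2]] : exists mu,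
    e1 0 1 * ad4 1 1 + e1 0 2 * ad4 2 1 = mu * e1 0 1
    /\ e1 0 1 * ad4 1 2 + e1 0 2 * ad4 2 2 = mu * e1 0 2.
  move/subr0_eq: W; set y2 := _ + _; set y1 := _ + _ => W.
  have [x1|x1] := eqVneq (e1 0 1) 0; last first.
    exists (y1 / e1 0 1); rewrite mulfVK //; split=> //.
    by rewrite mulrAC (mulrC y1) -W mulrC mulKf.
  have [x2|x2] := eqVneq (e1 0 2) 0.
    by exists 0; rewrite /y1 /y2 x1 x2 !mul0r addr0.
  exists (y2 / e1 0 2); rewrite mulfVK //; split=> //.
  by rewrite x1 mulr0; apply: (mulfI x2); rewrite -W x1 mul0r mulr0.
have e1E (u : g4_algebra g) : exists c,
    lie u e1 = (- (u 0 3 * mu)) *: e1 + c *: (E 1 : g4_algebra g).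
  have [w0 w1 w2 w3] := lie_coord u e1.
  exists (lie u e1 0 0 + u 0 3 * mu * e1 0 0).
  have mE (a b : g4_algebra g) k : (a + b) 0 k = a 0 k + b 0 k by rewrite !mxE.
  have sE a (b : g4_algebra g) k : (a *: b) 0 k = a * b 0 k by rewrite !mxE.
  apply: row4P; rewrite !(mE, sE) w1 w2 w3 e13 !mxE /=; split; try by ring.
    transitivity (- u 0 3 * (e1 0 1 * ad4 1 1 + e1 0 2 * ad4 2 1));
      first by ring.
    by rewrite mu1; ring.
  transitivity (- u 0 3 * (e1 0 1 * ad4 1 2 + e1 0 2 * ad4 2 2)); first by ring.
  by rewrite mu2; ring.
move=> v u /memv_addP[_ /vlineP[a ->] [_ /vlineP[b ->] ->]].
have [c ec] := e1E u.
rewrite g4_lieC rpredN (lieDr g4_lieC) !(lieZr g4_lieC) lie_E1 ec.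
rewrite scalerDr !scalerA -addrA -scalerDl.
by rewrite memv_add // rpredZ // memv_line.
Qed.

Lemma generating_sub_I3F p : generating p -> ~ (p <= I3 g)%VS.
Proof.
move=> gp pI; have I3f : I3 g = fullv.
  by apply: gp => // u v uI _; apply: I3_ideal uI.
by have := I3_dim g; rewrite I3f dimvf.
Qed.

Lemma generating_wedge p (e1 e2 : g4_algebra g) :
    basis_of p [:: e1; e2] -> e1 0 3 = 0 -> e2 0 3 = 1 ->
  generating p <-> wedge e1 != 0.
Proof.
move=> bp e13 e23; have pE := span_basis bp; split=> [gp|W H sH pH].
  apply/eqP => W; have idJ := wedge0_ideal e13 W.
  have := gp _ (subalgebra_ideal_line g4_lieC (x := e2) idJ).
  have sub : (p <= <[e1]> + <[E 1]> + <[e2]>)%VS.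
    by rewrite -pE span_cons span_seq1 addvS ?addvSl.
  have := dim_span [:: e1; E 1; e2]; rewrite !span_cons span_nil addv0 addvA.
  by move=> /[swap] /(_ sub) ->; rewrite dimvf.
have e1H : e1 \in H by apply: (subvP pH); rewrite -pE memv_span ?mem_head.
have e2H : e2 \in H.
  by apply: (subvP pH); rewrite -pE memv_span // !inE eqxx orbT.
have e3H := sH _ _ e1H e2H; have e4H := sH _ _ e1H e3H.
apply/eqP; rewrite eqEsubv subvf /= -(span_basis (basis_frame e13 e23 W)).
by apply/span_subvP => x; rewrite !inE => /or4P[] /eqP->.
Qed.

(** A vector of p in I is a multiple of [e1]. Were it a nonzero element of [J], then e1, e3, e4
    would lie in [J] and force dimension 3. *)
Lemma wedge_ideal_cap p J (e1 e2 : g4_algebra g) :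
    basis_of p [:: e1; e2] -> e1 0 3 = 0 -> e2 0 3 = 1 -> wedge e1 != 0 ->
  ideal J -> (J <= I3 g)%VS -> J <> I3 g -> (p :&: J = 0)%VS.
Proof.
move=> bp e13 e23 W idJ JI JnI; apply/eqP; rewrite -subv0; apply/subvP => w.
rewrite memv_cap memv0 -(span_basis bp) span_cons span_seq1.
case/andP=> /memv_addP[_ /vlineP[a ->] [_ /vlineP[b ->] ->]] wJ.
have := subvP JI _ wJ; rewrite mem_I3 !mxE e13 e23 mulr0 mulr1 add0r => /eqP b0.
move: wJ; rewrite b0 scale0r addr0 => wJ.
have [->|a0] := eqVneq a 0; first by rewrite scale0r.
case: JnI; apply/eqP; rewrite eqEdim JI I3_dim.
have e1J : e1 \in J by rewrite -(scalerK a0 e1) rpredZ.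
have e3J : lie e1 e2 \in J := idJ _ e2 e1J.
have e4J := idJ _ (lie e1 e2) e1J.
have sJ : (<<[:: e1; lie e1 e2; lie e1 (lie e1 e2)]>> <= J)%VS.
  by apply/span_subvP => x; rewrite !inE => /or3P[] /eqP->.
apply: leq_trans (dimvS sJ).
have /basis_free := basis_frame e13 e23 W.
rewrite (perm_free (_ : perm_eq _
  (e2 :: [:: e1; lie e1 e2; lie e1 (lie e1 e2)]))).
  by rewrite free_cons => /andP[_ /eqP->].
by rewrite (perm_catCA [:: e1] [:: e2]).
Qed.

(** * Structure constants of frames and transitivity of the automorphisms *)

Lemma lie_frame23 (e1 e2 : g4_algebra g) :
    basis_of fullv (frame e1 e2) -> e1 0 3 = 0 ->
  [/\ e2 0 3 != 0,
      struct_const (frame e1 e2) 2 3 1 = e2 0 3 ^+ 2 * ad4_det,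
      struct_const (frame e1 e2) 2 3 2 = 0 &
      lie e2 (lie e1 e2) = (e2 0 3 ^+ 2 * ad4_det) *: e1
        - (e2 0 3 * ad4_tr) *: lie e1 e2
        + struct_const (frame e1 e2) 2 3 4 *: lie e1 (lie e1 e2)].
Proof.
move=> be e13; have fr := basis_free be.
have e4n0 : lie e1 (lie e1 e2) != 0.
  by apply: free_not0 fr _; rewrite !inE eqxx !orbT.
have lW : e2 0 3 * wedge e1 != 0.
  by apply: contraNneq e4n0 => lW; rewrite lie_e1e3 // lW scale0r.
have [c cE] := lie_e2e3 e2 e13.
(* The E_1-term of [lie_e2e3] is rewritten as a multiple of e4, so that the formula is an expansion
   in the frame. *)
have cE' : lie e2 (lie e1 e2) = (e2 0 3 ^+ 2 * ad4_det) *: e1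
    - (e2 0 3 * ad4_tr) *: lie e1 e2
    + (c / (e2 0 3 * wedge e1)) *: lie e1 (lie e1 e2).
  by rewrite lie_e1e3 // scalerA mulfVK.
pose k (i : 'I_4) := nth 0 [:: e2 0 3 ^+ 2 * ad4_det; 0; - (e2 0 3 * ad4_tr);
  c / (e2 0 3 * wedge e1)] i.
have kE : lie e2 (lie e1 e2) = \sum_(i < 4) k i *: (frame e1 e2)`_i.
  by rewrite cE' !big_ord_recl big_ord0 /k /= scale0r add0r addr0 scaleNr addrA.
have sc i : struct_const (frame e1 e2) 2 3 i = k (inord i.-1).
  by rewrite /struct_const /= kE coord_sum_free.
rewrite !sc /k !inordK //=; split=> //.
by apply: contraNneq lW => ->; rewrite mul0r.
Qed.

Lemma adapted_frame p : \dim p = 2%N -> generating p ->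
  exists e1 e2 : g4_algebra g,
    [/\ adapted (I3 g) p e1 e2, wedge e1 != 0 & e2 0 3 = 1].
Proof.
move=> dp gp; have pI := generating_sub_I3F gp.
have [e1 [e2 [bp e13 e23]]] := plane_basis dp pI.
have W : wedge e1 != 0 by apply/(generating_wedge bp).
have [_ _ _ e23E] := lie_frame23 (basis_frame e13 e23 W) e13.
set c := struct_const _ _ _ _ in e23E.
(* This shift keeps e3 and e4 and changes [e2, e3] by - c e4, which cancels its e4-component. *)
pose e2' : g4_algebra g := e2 - c *: e1.
have e23' : e2' 0 3 = 1 by rewrite !mxE e13 mulr0 subr0.
have be' := basis_frame e13 e23' W.
have e3' : lie e1 e2' = lie e1 e2.
  by rewrite (lieDr g4_lieC) -scaleNr (lieZr g4_lieC) liexx scaler0 addr0.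
have pe1 : e1 \in p by rewrite -(span_basis bp) memv_span ?mem_head.
have pe2 : e2 \in p by rewrite -(span_basis bp) memv_span // !inE eqxx orbT.
exists e1, e2'; split=> //; split=> //.
- rewrite basisEfree dp leqnn andbT span_cons span_seq1 subv_add -!memvE pe1.
  rewrite rpredB ?rpredZ //= andbT.
  exact: (@catl_free _ _ [:: _; _] [:: _; _] (basis_free be')).
- by rewrite memv_cap pe1 mem_I3 e13 eqxx.
have [_ _ _] := lie_frame23 be' e13; rewrite e3' lieDl -scaleNr lieZl e23E.
rewrite e23 e23' scaleNr -!addrA => /addrI /addrI.
rewrite subrr => /esym/eqP; rewrite scaler_eq0 => /orP[/eqP //|/eqP e40].
have e4F : lie e1 (lie e1 e2) \in (frame e1 e2' : seq _).
  by rewrite !inE e3' eqxx !orbT.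
by have := free_not0 (basis_free be') e4F; rewrite e40 eqxx.
Qed.

Lemma lie_frame_eq (e1 e2 : g4_algebra g) : e1 0 3 = 0 ->
  [/\ lie e1 (lie e1 (lie e1 e2)) = 0,
      lie e2 (lie e1 (lie e1 e2)) = - (e2 0 3 * ad4_tr) *: lie e1 (lie e1 e2) &
      lie (lie e1 e2) (lie e1 (lie e1 e2)) = 0].
Proof.
move=> e13; rewrite (lie_e1e3 e2 e13) !(lieZr g4_lieC) !lie_E1 e13.
have [_ _ _ ->] := lie_coord e1 e2.
by rewrite !mul0r oppr0 !scale0r !scaler0 !scalerA [_ * - _]mulrC.
Qed.

(** Once C_{23}^4 = 0, all brackets of the frame are determined by det M, tr M and the
    E_4-coordinate of the second vector, so matching frames have the same table. *)
Lemma frame_automorphism (e1 e2 f1 f2 : g4_algebra g) :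
    basis_of fullv (frame e1 e2) -> basis_of fullv (frame f1 f2) ->
    struct_const (frame e1 e2) 2 3 4 = 0 ->
    struct_const (frame f1 f2) 2 3 4 = 0 ->
    e1 0 3 = 0 -> f1 0 3 = 0 -> e2 0 3 = f2 0 3 ->
  exists2 f : 'End(g4_algebra g), automorphism f & f e1 = f1 /\ f e2 = f2.
Proof.
move=> be bf ce cf e13 f13 ef3.
have [f] := automorphism_of_bases g4_lieC be bf.
move=> /= [h1 h2 h3 h4] hf; exists f => //; apply: hf.
have [_ _ _] := lie_frame23 be e13; rewrite ce scale0r addr0 => e23.
have [_ _ _] := lie_frame23 bf f13; rewrite cf scale0r addr0 => f23.
have [e14 e24 e34] := lie_frame_eq e2 e13.
have [f14 f24 f34] := lie_frame_eq f2 f13.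
case=> [[|[|[|[|//]]]] lti] [[|[|[|[|//]]]] ltj] //= _;
  rewrite ?(e14, e24, e34, e23) ?(f14, f24, f34, f23)
    ?linearB ?linearZ /= ?h1 ?h3 ?h4 ?linear0 // ef3 //.
Qed.

End G4.

Theorem theorem2 (R : realType) (g : g4 R) (hg : admissible g) :
  [/\ (exists2 p : {vspace g4_algebra g}, \dim p = 2%N & generating p)
        <-> g <> g48 1,
      forall p : {vspace g4_algebra g}, \dim p = 2%N ->
        (generating p <->
         ~ (p <= I3 g)%VS /\
         forall J : {vspace g4_algebra g},
           ideal J -> (J <= I3 g)%VS -> J <> I3 g -> (p :&: J = 0)%VS),
      forall p q : {vspace g4_algebra g},
        \dim p = 2%N -> \dim q = 2%N -> generating p -> generating q ->
        exists2 f : 'End(g4_algebra g), automorphism f & (f @: p)%VS = q &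
      forall p : {vspace g4_algebra g}, \dim p = 2%N -> generating p ->
        (exists e1 e2 : g4_algebra g, adapted (I3 g) p e1 e2) /\
        (forall e1 e2 : g4_algebra g, adapted (I3 g) p e1 e2 ->
           (g <> g48 0 ->
              struct_const (frame e1 e2) 2 3 1 <> 0 /\
              struct_const (frame e1 e2) 2 3 2 = 0) /\
           (g = g48 0 ->
              struct_const (frame e1 e2) 2 3 1 = 0 /\
              struct_const (frame e1 e2) 2 3 2 = 0))].
Proof.
split.
- split=> [[p dp gp] g1|g1].
    have [e1 [e2 [_ /eqP[]]]] := adapted_frame dp gp.
    exact: wedge_g48_1 g1.
  (* A vector of I whose class is not an eigenvector of M spans a generating plane together with
     E_4. *)
  have [u u3 W] := wedge_neq0 g1.
  have e43 : (E 4 : g4_algebra g) 0 3 = 1 by rewrite mxE.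
  have fp : free [:: u; E 4 : g4_algebra g].
    have /basis_free := basis_frame u3 e43 W.
    exact: (@catl_free _ _ [:: _; _] [:: _; _]).
  exists <<[:: u; E 4 : g4_algebra g]>>%VS; first exact/eqP.
  by apply/(generating_wedge _ u3 e43) => //; rewrite /basis_of eqxx.
- move=> p dp; split=> [gp|[pI hJ]].
    split; first exact: generating_sub_I3F.
    have [e1 [e2 [bp e13 e23]]] := plane_basis dp (generating_sub_I3F gp).
    have W : wedge e1 != 0 by apply/(generating_wedge bp).
    by move=> J; apply: wedge_ideal_cap bp e13 e23 W.
  have [e1 [e2 [bp e13 e23]]] := plane_basis dp pI.
  apply/(generating_wedge bp) => //; apply/eqP => W.
  have pe1 : e1 \in p by rewrite -(span_basis bp) memv_span ?mem_head.
  (* The ideal <e1, E_1> has dimension at most 2, hence differs from I, yet it meets p in [e1]. *)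
  have := hJ _ (wedge0_ideal e13 W).
  rewrite subv_add -!memvE !mem_I3 e13 eqxx mxE eqxx => /(_ isT) pJ.
  have /free_not0 /(_ (mem_head _ _)) := basis_free bp; rewrite -memv0 -pJ.
    by rewrite memv_cap pe1 (subvP (addvSl _ _)) ?memv_line.
  move=> JI; have := dim_span [:: e1; E 1]; rewrite !span_cons span_nil addv0.
  by rewrite JI I3_dim.
- move=> p q dp dq gp gq.
  have [e1 [e2 [[bp + be ce] _ e23]]] := adapted_frame dp gp.
  rewrite memv_cap mem_I3 => /andP[_ /eqP e13].
  have [f1 [f2 [[bq + bf cf] _ f23]]] := adapted_frame dq gq.
  rewrite memv_cap mem_I3 => /andP[_ /eqP f13].
  have ef3 : e2 0 3 = f2 0 3 by rewrite e23.
  have [f autf [fe1 fe2]] := frame_automorphism be bf ce cf e13 f13 ef3.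
  exists f => //.
  by rewrite -(span_basis bp) -(span_basis bq) limg_span /= fe1 fe2.
- move=> p dp gp; split.
    by have [e1 [e2 []]] := adapted_frame dp gp; exists e1, e2.
  move=> e1 e2 [_ + be _]; rewrite memv_cap mem_I3 => /andP[_ /eqP e13].
  (* C_{23}^1 is det M times the square of the E_4-coordinate of [e2], which is nonzero but may
     differ from 1 in an arbitrary adapted basis. *)
  have [l0 -> -> _] := lie_frame23 be e13.
  split=> [g0|/ad4_det_eq0 ->]; last by rewrite mulr0.
  split=> // /eqP; rewrite mulf_eq0 expf_eq0 (negPf l0) andbF /=.
  by move=> /eqP /ad4_det_eq0.
Qed.
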